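(* For every positive integer $n$, $$\prod_{i=1}^{n-1}(2i-1)\;\le\;T(1^n)\;\le\;2^{\binom{n-2}{2}-1}\cdot 3^n,$$ where $\binom{n-2}{2}=(n-2)(n-3)/2$.
   Context: Let $U_n$ be the set of $n\times n$ upper-triangular matrices with nonnegative integer entries. For $A=(a_{i,j})\in U_n$, the $k$-th hook sum is $h_k=(a_{k,k}+\cdots+a_{k,n})-(a_{1,k}+\cdots+a_{k-1,k})$. A Tesler matrix is one with $h_k=1$ for all $1\le k\le n$, and $T(1^n)$ is the number of $n\times n$ Tesler matrices. *)

(* Defs.v *)
From mathcomp Require Export all_boot all_order all_algebra.
From mathcomp Require Export finmap.
From mathcomp Require Export boolp classical_sets cardinality.
Import Order.TTheory GRing.Theory Num.Theory.
Set Implicit Arguments.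
Unset Strict Implicit.
Unset Printing Implicit Defensive.

Local Open Scope classical_set_scope.
Local Open Scope ring_scope.

(* Rows and columns are indexed from 0, so the index k below stands for k+1 in
   the usual 1-based numbering. *)

Definition upper_triangular (n : nat) (A : 'M[nat]_n) : Prop :=
  forall i j : 'I_n, (j < i)%N -> A i j = 0%N.

Definition hook_sum (n : nat) (A : 'M[nat]_n) (k : 'I_n) : int :=
  \sum_(j < n | (k <= j)%N) (A k j)%:Z - \sum_(i < n | (i < k)%N) (A i k)%:Z.

Definition tesler (n : nat) : set 'M[nat]_n :=
  [set A | upper_triangular A /\ forall k : 'I_n, hook_sum A k = 1].

(* [fset_set] is the empty set on infinite sets; [finite_tesler] below shows
   that this default value is never used here. *)
Definition tesler_number (n : nat) : nat := #|` fset_set (@tesler n)|.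

Lemma tesler_entry_le (n : nat) (A : 'M[nat]_n) :
  tesler A -> forall i j : 'I_n, (A i j <= 2 ^ i)%N.
Proof.
move=> [upA hA] i j; have [m lt_im] := ubnP (nat_of_ord i).
elim: m => // m IHm in i j lt_im *.
case: (leqP i j) => [le_ij|lt_ji]; last by rewrite upA.
have /eqP := hA i; rewrite /hook_sum subr_eq -!(rmorph_sum Posz) 
  -(rmorphD Posz 1%N).
move=> /eqP[eq_row].
apply: (@leq_trans (\sum_(j < n | (i <= j)%N) A i j)%N).
  by rewrite (bigD1 j) //= leq_addr.
have -> : (2 ^ i = 1 + \sum_(l < i) 2 ^ l)%N.
  by have := predn_exp 2 i; rewrite mul1n => <-; rewrite add1n prednK ?expn_gt0.
rewrite eq_row leq_add2l (big_ord_widen n (expn 2)); last exact: ltnW.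
apply: leq_sum => l lt_li; apply: IHm.
by rewrite (leq_trans lt_li) // -ltnS.
Qed.

Lemma finite_tesler (n : nat) : finite_set (@tesler n).
Proof.
pose f (B : 'M['I_(2 ^ n).+1]_n) : 'M[nat]_n := map_mx (@nat_of_ord _) B.
apply: (@sub_finite_set _ _ (f @` setT)); last first.
  exact/finite_image/finite_finset.
move=> A tA; exists (\matrix_(i, j) inord (A i j)) => //.
apply/matrixP => i j; rewrite !mxE inordK // ltnS.
by apply: leq_trans (tesler_entry_le tA i j) _; rewrite leq_exp2l // ltnW.
Qed.

(* Main.v *)
(* Merging the last column of a Tesler matrix into its diagonal gives a Tesler
   matrix B of size one less, and B arises once for each way of choosing a new
   diagonal entry f_i <= c_i := B_ii for every i; the new corner entry is then
   1 + sum_i (c_i - f_i).  Hence T(1^(n+1)) = sum_B prod_i (1 + c_i).  Applying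
   this twice and summing over f gives the exact formula
     T(1^(n+2)) = (n + 6) / 3 * sum_B prod_i (1 + c_i) (2 + c_i) / 2,
   B running over the Tesler matrices of size n.  As sum_i c_i = n, the product
   of the (2 + c_i) / 2 lies between 1 + n / 2 and (3 / 2)^n, which bounds the
   ratio T(1^(n+2)) / T(1^(n+1)) from both sides. *)
Require Import Defs.
From mathcomp Require Import ring lra zify.
Import Order.TTheory GRing.Theory Num.Theory.
Set Implicit Arguments.
Unset Strict Implicit.
Unset Printing Implicit Defensive.
Local Open Scope ring_scope.

(** * Removing and restoring the last row and column *)

Lemma sum_ord_lift_max (V : nmodType) (n : nat) (F : 'I_n.+1 -> V) :
  \sum_i F i = \sum_(i < n) F (lift ord_max i) + F ord_max.
Proof.
rewrite big_ord_recr /=; congr (_ + _); apply: eq_bigr => i _.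
by congr F; apply: val_inj; exact: (esym (lift_max i)).
Qed.

Lemma prod_ord_lift_max (R : pzSemiRingType) (n : nat) (F : 'I_n.+1 -> R) :
  \prod_i F i = (\prod_(i < n) F (lift ord_max i)) * F ord_max.
Proof.
rewrite big_ord_recr /=; congr (_ * _); apply: eq_bigr => i _.
by congr F; apply: val_inj; exact: (esym (lift_max i)).
Qed.

Definition merge_last (n : nat) (A : 'M[nat]_n.+1) : 'M[nat]_n :=
  \matrix_(i, j) (A (lift ord_max i) (lift ord_max j)
                  + (if i == j then A (lift ord_max i) ord_max else 0))%N.

(** Inverse of [merge_last] once [f] stays below the diagonal of [B], where the truncated
    subtraction is a true one. The corner is the value that the last hook sum forces. *)
Definition split_last (n : nat) (B : 'M[nat]_n) (f : 'I_n -> nat) :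
  'M[nat]_n.+1 :=
  \matrix_(i, j)
    match unlift ord_max i, unlift ord_max j with
    | Some i', Some j' => if i' == j' then f i' else B i' j'
    | Some i', None => (B i' i' - f i')%N
    | None, Some _ => 0%N
    | None, None => (1 + \sum_(l < n) (B l l - f l))%N
    end.

(** Merging only moves the last entry of row i onto the diagonal, inside the same row sum; the
    column part of a hook lies strictly above the diagonal and does not change. *)
Lemma hook_sum_merge_last (n : nat) (A : 'M[nat]_n.+1) (i : 'I_n) :
  hook_sum A (lift ord_max i) = hook_sum (merge_last A) i.
Proof.
rewrite /hook_sum big_mkcond sum_ord_lift_max [X in _ - X]big_mkcond.
rewrite [X in _ - X]sum_ord_lift_max !lift_max.
have le_in : (i <= @ord_max n)%N by rewrite ltnW /=.
rewrite le_in ltnNge le_in [in X in _ - X]addr0; congr (_ - _).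
- rewrite (eq_bigr (fun j : 'I_n => (if (i <= j)%N
      then (A (lift ord_max i) (lift ord_max j))%:Z else 0))); last first.
    by move=> j _; rewrite lift_max.
  rewrite -big_mkcond /=.
  rewrite [RHS](eq_bigr (fun j => (A (lift ord_max i) (lift ord_max j))%:Z
      + (if i == j then (A (lift ord_max i) ord_max)%:Z else 0))); last first.
    by move=> j _; rewrite mxE PoszD; case: eqP.
  rewrite big_split /=; congr (_ + _).
  rewrite (bigD1 i) //= eqxx big1 ?addr0 //.
  by move=> j /andP[_ /negPf]; rewrite eq_sym => ->.
- rewrite [RHS]big_mkcond; apply: eq_bigr => j _; rewrite lift_max mxE.
  case: ltnP => // lt_ji; case: eqP => [eq_ji|_]; last by rewrite addn0.
  by rewrite eq_ji ltnn in lt_ji.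
Qed.

Lemma hook_sum_ord_max (n : nat) (A : 'M[nat]_n.+1) :
  hook_sum A ord_max
    = (A ord_max ord_max)%:Z - (\sum_(i < n) A (lift ord_max i) ord_max)%N%:Z.
Proof.
rewrite /hook_sum big_mkcond sum_ord_lift_max [X in _ - X]big_mkcond.
rewrite [X in _ - X]sum_ord_lift_max ltnn leqnn [in X in _ - X]addr0.
rewrite big1 ?add0r; last by move=> j _; rewrite lift_max leqNgt ltn_ord.
rewrite (rmorph_sum Posz); congr (_ - _).
by apply: eq_bigr => j _; rewrite lift_max ltn_ord.
Qed.

Lemma tesler_succP (n : nat) (A : 'M[nat]_n.+1) :
  tesler A <->
  [/\ forall j, A ord_max (lift ord_max j) = 0%N,
      tesler (merge_last A)
    & A ord_max ord_max = (1 + \sum_(i < n) A (lift ord_max i) ord_max)%N].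
Proof.
split=> [[upA hA]|[lastA [upB hB] cornerA]]; split.
- by move=> j; apply: upA; rewrite lift_max ltn_ord.
- split=> [i j lt_ji|k]; last by rewrite -hook_sum_merge_last.
  rewrite mxE upA ?lift_max //.
  by case: eqP => // eq_ij; rewrite eq_ij ltnn in lt_ji.
- have := hA ord_max; rewrite hook_sum_ord_max; lia.
- move=> i j; case: (unliftP ord_max i) => [i'|] ->.
    case: (unliftP ord_max j) => [j'|] ->; rewrite !lift_max.
      by move=> /upB; rewrite mxE => /eqP; rewrite addn_eq0 => /andP[/eqP].
    by rewrite ltnNge (ltnW (ltn_ord i')).
  by case: (unliftP ord_max j) => [j'|] -> //=; rewrite ltnn.
- move=> k; case: (unliftP ord_max k) => [k'|] ->.
    by rewrite hook_sum_merge_last.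
  by rewrite hook_sum_ord_max cornerA; lia.
Qed.

Lemma split_lastK (n : nat) (B : 'M[nat]_n) (f : 'I_n -> nat) :
  (forall i, f i <= B i i)%N -> merge_last (split_last B f) = B.
Proof.
move=> le_fB; apply/matrixP => i j; rewrite !mxE !liftK unlift_none.
by case: eqP => [->|_]; rewrite ?subnKC ?addn0.
Qed.

Lemma split_last_diag (n : nat) (B : 'M[nat]_n) (f : 'I_n -> nat) i :
  split_last B f (lift ord_max i) (lift ord_max i) = f i.
Proof. by rewrite mxE liftK eqxx. Qed.

Lemma split_last_corner (n : nat) (B : 'M[nat]_n) (f : 'I_n -> nat) :
  split_last B f ord_max ord_max = (1 + \sum_(l < n) (B l l - f l))%N.
Proof. by rewrite mxE unlift_none. Qed.

Lemma merge_lastK (n : nat) (A : 'M[nat]_n.+1) (f : 'I_n -> nat) :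
  tesler A -> (forall i, f i = A (lift ord_max i) (lift ord_max i)) ->
  split_last (merge_last A) f = A.
Proof.
move=> /tesler_succP[lastA _ cornerA] fE; apply/matrixP => i j.
have subE l : (merge_last A l l - f l)%N = A (lift ord_max l) ord_max.
  by rewrite fE mxE eqxx addKn.
case: (unliftP ord_max i) => [i'|] ->; case: (unliftP ord_max j) => [j'|] ->;
  rewrite mxE ?liftK ?unlift_none.
- by rewrite mxE fE; case: eqP => [->|_] //; rewrite addn0.
- by rewrite subE.
- by rewrite lastA.
- by rewrite cornerA; congr (_ + _)%N; apply: eq_bigr => l _; rewrite subE.
Qed.

Lemma tesler_split_last (n : nat) (B : 'M[nat]_n) (f : 'I_n -> nat) :
  tesler B -> (forall i, f i <= B i i)%N -> tesler (split_last B f).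
Proof.
move=> tB le_fB; apply/tesler_succP; split.
- by move=> j; rewrite mxE unlift_none liftK.
- by rewrite split_lastK.
- rewrite split_last_corner; congr (_ + _)%N; apply: eq_bigr => l _.
  by rewrite mxE liftK unlift_none.
Qed.

(** Merging adds the last column to the diagonal and drops a corner that is one more than the sum of
    that column, so each size contributes exactly 1. *)
Lemma tesler_diag_sum (n : nat) (A : 'M[nat]_n) :
  tesler A -> (\sum_i A i i = n)%N.
Proof.
elim: n A => [|n IHn] A tA; first by rewrite big_ord0.
have [_ /IHn sumB cornerA] := (tesler_succP A).1 tA.
have -> : (\sum_i A i i
    = \sum_(i < n) A (lift ord_max i) (lift ord_max i) + A ord_max ord_max)%N.
  exact: sum_ord_lift_max.
rewrite cornerA -[in RHS]sumB.
rewrite [in RHS](eq_bigr (fun i => A (lift ord_max i) (lift ord_max i)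
  + A (lift ord_max i) ord_max)%N).
  by rewrite big_split /= addnCA add1n.
by move=> i _; rewrite mxE eqxx.
Qed.

Lemma tesler_diag_le (n : nat) (A : 'M[nat]_n) i : tesler A -> (A i i <= n)%N.
Proof.
by move=> /tesler_diag_sum sumA; rewrite -[leqRHS]sumA (bigD1 i) //= leq_addr.
Qed.

(** * Enumerating the Tesler matrices of the next size *)

Definition tesler_seq (n : nat) : seq 'M[nat]_n := fset_set (@tesler n).

Lemma mem_tesler_seq (n : nat) (A : 'M[nat]_n) :
  reflect (tesler A) (A \in tesler_seq n).
Proof.
by rewrite /tesler_seq in_fset_set; [apply: (iffP idP); rewrite in_setE
                                    | exact: finite_tesler].
Qed.

(** A finite codomain makes sums over f available; for Tesler [B] it cuts off no choice, since
    diagonal entries are at most n by [tesler_diag_le]. *)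
Definition below_diag (n : nat) (B : 'M[nat]_n) :
  pred {ffun 'I_n -> 'I_n.+1} :=
  family (fun i => [pred x : 'I_n.+1 | (x <= B i i)%N]).

Lemma below_diagP (n : nat) (B : 'M[nat]_n) (f : {ffun 'I_n -> 'I_n.+1}) :
  reflect (forall i, f i <= B i i)%N (f \in below_diag B).
Proof. exact: forallP. Qed.

(** No repetition occurs: merging recovers [B], and the diagonal then recovers [f]. *)
Lemma perm_tesler_seq_succ (n : nat) :
  perm_eq (tesler_seq n.+1)
    [seq split_last B (fun i => val (f i)) |
       B : 'M[nat]_n <- tesler_seq n,
       f : {ffun 'I_n -> 'I_n.+1} <- enum (below_diag B)].
Proof.
apply: uniq_perm; first exact: fset_uniq.
  apply: allpairs_uniq_dep.
  - exact: fset_uniq.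
  - by move=> B _; exact: enum_uniq.
  move=> _ _ /allpairsPdep[B [f [_ fB ->]]] /allpairsPdep[C [g [_ gC ->]]] /=.
  have {}fB : forall i, (f i <= B i i)%N by apply/below_diagP; rewrite -mem_enum.
  have {}gC : forall i, (g i <= C i i)%N by apply/below_diagP; rewrite -mem_enum.
  move=> eqBC; have eq_BC : B = C.
    by rewrite -(split_lastK fB) eqBC split_lastK.
  rewrite -{}eq_BC in eqBC *; congr (Tagged _ _); apply/ffunP => i.
  apply: val_inj; have /matrixP := eqBC.
  by move=> /(_ (lift ord_max i) (lift ord_max i)); rewrite !split_last_diag.
move=> A; apply/mem_tesler_seq/allpairsPdep => [tA|[B [f [tB fB ->]]]].
  have [_ tB _] := (tesler_succP A).1 tA.
  have le_diag i : (A (lift ord_max i) (lift ord_max i) <= merge_last A i i)%N.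
    by rewrite mxE eqxx leq_addr.
  (* The default value of [inord] never occurs: the entry is at most a diagonal entry of the merged
     Tesler matrix, hence at most n. *)
  have fE i : @inord n (A (lift ord_max i) (lift ord_max i))
              = A (lift ord_max i) (lift ord_max i) :> nat.
    by rewrite inordK // ltnS (leq_trans (le_diag i)) ?tesler_diag_le.
  exists (merge_last A), [ffun i => inord (A (lift ord_max i) (lift ord_max i))].
  split; first exact/mem_tesler_seq.
    by rewrite mem_enum; apply/below_diagP => i; rewrite ffunE fE.
  by rewrite merge_lastK // => i; rewrite ffunE -[RHS]fE.
apply: tesler_split_last; first exact/mem_tesler_seq.
by apply/below_diagP; rewrite -mem_enum.
Qed.

Lemma sum_tesler_succ (V : nmodType) (n : nat) (F : 'M[nat]_n.+1 -> V) :
  \sum_(A <- tesler_seq n.+1) F A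
    = \sum_(B <- tesler_seq n) \sum_(f in below_diag B)
        F (split_last B (fun i => val (f i))).
Proof.
rewrite (perm_big _ (perm_tesler_seq_succ n)) big_allpairs_dep.
by apply: eq_bigr => B _; rewrite big_enum.
Qed.

(** * Exact formulas for one and two steps of the recursion *)

Lemma tesler_numberE (R : pzSemiRingType) (n : nat) :
  (tesler_number n)%:R = \sum_(A <- tesler_seq n) 1 :> R.
Proof. by rewrite big_const_seq count_predT iter_addr addr0. Qed.

Lemma sum_below_diag_prod (R : comPzSemiRingType) (n : nat) (B : 'M[nat]_n)
    (G : 'I_n -> nat -> R) :
  tesler B ->
  \sum_(f in below_diag B) \prod_i G i (f i)
    = \prod_i \sum_(x < (B i i).+1) G i x.
Proof.
move=> tB.
rewrite -(bigA_distr_big_dep (fun i (x : 'I_n.+1) => (x <= B i i)%N)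
  (fun i (x : 'I_n.+1) => G i x)).
by apply: eq_bigr => i _; rewrite (big_ord_widen n.+1) // ltnS tesler_diag_le.
Qed.

Lemma tesler_number_succ (n : nat) :
  (tesler_number n.+1)%:R
    = \sum_(B <- tesler_seq n) \prod_i (1 + (B i i)%:R) :> rat.
Proof.
rewrite tesler_numberE sum_tesler_succ; apply: eq_big_seq => B.
move=> /mem_tesler_seq tB.
transitivity (\sum_(f in below_diag B) \prod_(i < n) (1 : rat)).
  by apply: eq_bigr => f _; rewrite big1.
rewrite (sum_below_diag_prod (fun _ _ => 1) tB).
by apply: eq_bigr => i _; rewrite sumr_const card_ord nat1r.
Qed.

Lemma sum_ord_succ (c : nat) :
  \sum_(x < c.+1) (1 + x%:R) = (1 + c%:R) * ((2 + c%:R) / 2) :> rat.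
Proof.
elim: c => [|c IHc]; first by rewrite big_ord1 /= !addr0.
by rewrite big_ord_recr /= IHc -(nat1r c); field.
Qed.

(** Under the weights 1 + x on 0, ..., c the mean of x is 2c/3; the total weight from [sum_ord_succ]
    is kept as a separate factor. *)
Lemma sum_ord_succ_mul (c : nat) :
  \sum_(x < c.+1) (1 + x%:R) * x%:R
    = (1 + c%:R) * ((2 + c%:R) / 2) * (2 / 3 * c%:R) :> rat.
Proof.
elim: c => [|c IHc]; first by rewrite big_ord1 !mulr0.
by rewrite big_ord_recr /= IHc -(nat1r c); field.
Qed.

Lemma tesler_number_succ2 (n : nat) :
  (tesler_number n.+2)%:R
    = (n%:R + 6) / 3 * \sum_(B <- tesler_seq n)
        ((\prod_i (1 + (B i i)%:R)) * \prod_i ((2 + (B i i)%:R) / 2)) :> rat.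
Proof.
rewrite tesler_number_succ sum_tesler_succ mulr_sumr; apply: eq_big_seq => B.
move=> /mem_tesler_seq tB; set P := (X in _ = _ * X).
have sumB : \sum_i (B i i)%:R = n%:R :> rat.
  by rewrite -natr_sum tesler_diag_sum.
have sum_prod : \sum_(f in below_diag B) \prod_i (1 + (f i)%:R) = P.
  rewrite (sum_below_diag_prod (fun _ x => 1 + x%:R) tB) /P -big_split /=.
  by apply: eq_bigr => i _; rewrite sum_ord_succ.
have sum_prod_mul k :
    \sum_(f in below_diag B) (\prod_i (1 + (f i)%:R)) * (f k)%:R
    = P * (2 / 3 * (B k k)%:R).
  (* The extra factor [f k] is absorbed into the k-th factor, so the summand is again a product over
     coordinates. *)
  pose G i x : rat := (1 + x%:R) * (if i == k then x%:R else 1).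
  rewrite (eq_bigr (fun f : {ffun 'I_n -> 'I_n.+1} => \prod_i G i (f i))).
    rewrite (sum_below_diag_prod G tB) (bigD1 k) //= /P -big_split /=.
    rewrite [in RHS](bigD1 k) //= [RHS]mulrAC; congr (_ * _).
      by rewrite -sum_ord_succ_mul; apply: eq_bigr => x _; rewrite /G eqxx.
    apply: eq_bigr => i /negPf ne_ik; rewrite -sum_ord_succ.
    by apply: eq_bigr => x _; rewrite /G ne_ik mulr1.
  by move=> f _; rewrite big_split /= -big_mkcond /= big_pred1_eq.
(* The corner contributes 1 + (1 + sum of (c_i - f_i)) = n + 2 - sum of f_i. *)
transitivity (\sum_(f in below_diag B)
    ((n%:R + 2) * \prod_i (1 + (f i)%:R)
     - \sum_k (\prod_i (1 + (f i)%:R)) * (f k)%:R) : rat).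
  apply: eq_bigr => f /below_diagP fB; rewrite prod_ord_lift_max.
  rewrite [X in X * _](eq_bigr (fun i => 1 + (f i)%:R)) => [|i _]; last first.
    by rewrite split_last_diag.
  rewrite split_last_corner -mulr_sumr natrD natr_sum.
  have -> : \sum_(l < n) (B l l - f l)%:R
            = \sum_(l < n) ((B l l)%:R - (f l)%:R) :> rat.
    by apply: eq_bigr => l _; rewrite natrB.
  by rewrite sumrB sumB; ring.
rewrite sumrB -mulr_sumr sum_prod exchange_big /=.
under eq_bigr do rewrite sum_prod_mul.
(* The coefficient is n + 2 - 2n/3 = (n + 6)/3. *)
by rewrite -mulr_sumr -mulr_sumr sumB; field.
Qed.

(** * Bounds for products over the diagonal *)

Lemma prod_onep_ge (R : realDomainType) (n : nat) (x : 'I_n -> R) :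
  (forall i, 0 <= x i) -> 1 + \sum_i x i <= \prod_i (1 + x i).
Proof.
(* Nonnegativity of the partial sums joins the invariant, so that the cross term a * b can be
   discarded. *)
move=> x_ge0; apply: (@proj2 (0 <= \sum_i x i)).
elim/big_ind2: _ => [|a p b q [a0 ap] [b0 bq]|i _] //.
- by rewrite addr0.
- split; first exact: addr_ge0.
  apply: le_trans (ler_pM _ _ ap bq); rewrite ?addr_ge0 //.
  by have := mulr_ge0 a0 b0; nra.
Qed.

(* A majorant geometric in c, exact at c = 1 and c = 2: the product over the
   diagonal then depends only on the sum of the entries. *)
Lemma half_succ2_le (c : nat) :
  (2 + c%:R) / 2 <= 3 / 2 * (3 / 4) * (4 / 3) ^+ c :> rat.
Proof.
(* Passing from c to c + 1 requires 1 <= c, so 0 is treated apart. *)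
case: c => [|c]; first by rewrite expr0; lra.
elim: c => [|c IHc]; first by rewrite expr1; lra.
rewrite exprS -(nat1r c.+1); have : 1 <= c.+1%:R :> rat by rewrite ler1n.
lra.
Qed.

Lemma prod_half_succ2_le (n : nat) (c : 'I_n -> nat) :
  (\sum_i c i = n)%N ->
  \prod_i ((2 + (c i)%:R) / 2) <= (3 / 2) ^+ n :> rat.
Proof.
move=> sum_c.
apply: (@le_trans _ _ (\prod_i (3 / 2 * (3 / 4) * (4 / 3) ^+ c i))).
  apply: ler_prod => i _; rewrite half_succ2_le andbT.
  by rewrite divr_ge0 // addr_ge0.
(* There are n factors and the exponents add up to n, so both powers are n-th powers, and 9/8 * 4/3
   = 3/2. *)
rewrite big_split /= prodr_const card_ord prodrXr sum_c -exprMn.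
by rewrite le_eqVlt; apply/orP; left; apply/eqP; congr (_ ^+ n); field.
Qed.

Lemma prod_half_succ2_ge (n : nat) (c : 'I_n -> nat) :
  (\sum_i c i = n)%N ->
  1 + n%:R / 2 <= \prod_i ((2 + (c i)%:R) / 2) :> rat.
Proof.
move=> sum_c; rewrite (eq_bigr (fun i => 1 + (c i)%:R / 2)); last first.
  by move=> i _; field.
rewrite -[in X in X / 2]sum_c natr_sum mulr_suml; apply: prod_onep_ge => i.
exact: divr_ge0.
Qed.

(** * Bounds for the ratio of consecutive Tesler numbers *)

Lemma tesler_number_succ2_le (n : nat) :
  (tesler_number n.+2)%:R
    <= (n%:R + 6) / 3 * (3 / 2) ^+ n * (tesler_number n.+1)%:R :> rat.
Proof.
rewrite tesler_number_succ2 tesler_number_succ -[leRHS]mulrA; apply: ler_wpM2l.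
  by rewrite divr_ge0 ?addr_ge0.
rewrite mulr_sumr big_seq [leRHS]big_seq.
apply: ler_sum => B /mem_tesler_seq tB.
rewrite mulrC; apply: ler_wpM2r; last exact/prod_half_succ2_le/tesler_diag_sum.
by apply: prodr_ge0 => i _; rewrite addr_ge0.
Qed.

Lemma tesler_number_succ2_ge (n : nat) :
  (2 * n.+1%:R - 1) * (tesler_number n.+1)%:R <= (tesler_number n.+2)%:R :> rat.
Proof.
apply: (@le_trans _ _
  ((n%:R + 6) / 3 * ((1 + n%:R / 2) * (tesler_number n.+1)%:R))).
  rewrite mulrA; apply: ler_wpM2r => //; rewrite -(nat1r n).
  (* The gap between (n + 6)/3 * (1 + n/2) and 2n + 1 is ((n - 2)^2 + 2)/6. *)
  by have := sqr_ge0 (n%:R - 2 : rat); nra.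
rewrite tesler_number_succ2 tesler_number_succ; apply: ler_wpM2l.
  by rewrite divr_ge0 ?addr_ge0.
rewrite mulr_sumr big_seq [leRHS]big_seq.
apply: ler_sum => B /mem_tesler_seq tB.
rewrite mulrC; apply: ler_wpM2l; last exact/prod_half_succ2_ge/tesler_diag_sum.
by apply: prodr_ge0 => i _; rewrite addr_ge0.
Qed.

(** * Small sizes and the final inductions *)

Lemma tesler_number0 : tesler_number 0 = 1%N.
Proof.
rewrite /tesler_number (_ : fset_set _ = [fset (0 : 'M[nat]_0)]%fset).
  by rewrite cardfs1.
apply/fsetP => A; rewrite in_fset_set; last exact: finite_tesler.
rewrite inE [A]flatmx0 eqxx.
by apply: mem_set; split=> [[]|[]].
Qed.

Lemma tesler_number1 : (tesler_number 1)%:R = 1 :> rat.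
Proof.
transitivity ((tesler_number 0)%:R : rat); last by rewrite tesler_number0.
rewrite tesler_number_succ tesler_numberE.
by apply: eq_bigr => B _; rewrite big_ord0.
Qed.

Lemma tesler_number_ge (n : nat) :
  \prod_(1 <= i < n.+1) (2 * i%:R - 1) <= (tesler_number n.+1)%:R :> rat.
Proof.
elim: n => [|n IHn]; first by rewrite big_geq // tesler_number1.
rewrite big_nat_recr //= mulrC.
apply: le_trans (tesler_number_succ2_ge n); apply: ler_wpM2l => //.
have : 1 <= n.+1%:R :> rat by rewrite ler1n.
lra.
Qed.

Lemma tesler_number2_le : (tesler_number 2)%:R <= 2 :> rat.
Proof.
by have := tesler_number_succ2_le 0; rewrite tesler_number1 expr0; lra.
Qed.

(** The left side is the ratio bound from size n + 3 to n + 4, the right side the growth of the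
    claimed bound. There is equality at n = 0; afterwards the left side grows by 3/2 * (n + 9)/(n +
    8), which is below 2. *)
Lemma tesler_ratio_le (n : nat) :
  (n%:R + 8) / 3 * (3 / 2) ^+ n.+2 <= 3 * 2 ^+ n.+1 :> rat.
Proof.
elim: n => [|n IHn]; first by rewrite !exprS expr0; lra.
rewrite (exprS _ n.+2) [in leRHS]exprS -(nat1r n).
have : 0 <= (3 / 2) ^+ n.+2 :> rat by apply: exprn_ge0; lra.
have : 0 <= n%:R :> rat by [].
nra.
Qed.

Lemma tesler_number_succ3_le (n : nat) :
  (tesler_number n.+3)%:R <= 2 ^+ 'C(n.+1, 2) / 2 * 3 ^+ n.+3 :> rat.
Proof.
elim: n => [|n IHn].
  have := tesler_number_succ2_le 1; have := tesler_number2_le.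
  by rewrite !exprS expr0; lra.
apply: le_trans (tesler_number_succ2_le n.+2) _.
have -> : n.+2%:R + 6 = n%:R + 8 :> rat by rewrite -addn2 natrD; ring.
apply: le_trans (ler_pM _ _ (tesler_ratio_le n) IHn) _ => //.
  by apply: mulr_ge0; [rewrite divr_ge0 ?addr_ge0 | apply: exprn_ge0; lra].
(* By Pascal's rule the binomial exponent grows by n + 1, which matches the power of 2 in
   [tesler_ratio_le]. *)
rewrite (binS n.+1) bin1 exprD (exprS 3 n.+3) le_eqVlt; apply/orP; left; apply/eqP.
by field.
Qed.

Theorem mainTheorem13 (n : nat) (n_gt0 : (0 < n)%N) :
  \prod_(1 <= i < n) (2 * i%:R - 1) <= (tesler_number n)%:R :> rat
  /\ (tesler_number n)%:R
       <= (2 : rat) ^ ((((n%:Z - 2) * (n%:Z - 3)) %/ 2)%Z - 1) * 3 ^+ n.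
Proof.
split; first by case: n n_gt0 => // n _; exact: tesler_number_ge.
case: n n_gt0 => [|[|[|n]]] // _.
(* For sizes 1 and 2 the integer exponent of 2 is 0 and -1, so the bounds are 3 and 9/2. *)
- by rewrite tesler_number1.
- by apply: le_trans tesler_number2_le _.
apply: le_trans (tesler_number_succ3_le n) _.
have -> : (((n.+3%:Z - 2) * (n.+3%:Z - 3)) %/ 2)%Z = 'C(n.+1, 2).
  have -> : (n.+3%:Z - 2) * (n.+3%:Z - 3) = (n.+1 * n)%N by lia.
  by rewrite divz_nat bin2 divn2.
by rewrite expfzDr // exprN1 -exprnP.
Qed.
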